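(* Let $\mathbb{K}$ be a countably infinite field with $\operatorname{char}(\mathbb{K})\neq2$, and let $E\subset\mathbb{K}^2$ have positive upper Banach density. Then for every $z\in\mathbb{K}$ there exist $(x_1,x_2),(y_1,y_2)\in E$ such that $$(x_1-y_1)^2-(x_2-y_2)^2=z.$$
   Context: Upper Banach density is taken in the additive group $A=(\mathbb{K}^2,+)$: a Følner sequence is a sequence $(F_n)$ of non-empty finite subsets of $A$ with $|F_n\cap(F_n+b)|/|F_n|\to1$ for every $b\in A$, and $d^*(E)=\sup_{(F_n)}\limsup_{n\to\infty}|E\cap F_n|/|F_n|$, the supremum being over all such sequences. *)

(* Defs.v *)
From mathcomp Require Import all_boot all_order all_algebra finmap.
From mathcomp Require Import all_classical all_reals all_analysis.

Set Implicit Arguments.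
Unset Strict Implicit.
Unset Printing Implicit Defensive.

Import Order.TTheory GRing.Theory Num.Theory.
Import numFieldNormedType.Exports.

Local Open Scope classical_set_scope.
Local Open Scope ring_scope.

Definition ftranslate (A : zmodType) (F : {fset A}) (b : A) : {fset A} :=
  [fset (x + b)%R | x in F]%fset.

Definition folner_seq (R : realType) (A : zmodType) (F : nat -> {fset A}) : Prop :=
  (forall n, F n != fset0) /\
  forall b : A,
    (fun n => (#|` (F n `&` ftranslate (F n) b)%fset |)%:R / (#|` F n|)%:R : R)
      @ \oo --> (1 : R).

Definition rel_density (R : realType) (A : zmodType) (E : set A) (F : {fset A}) : R :=
  (#|` [fset x in F | x \in E]%fset |)%:R / (#|` F|)%:R.

(* An uncountable group has no Følner sequence, and its density is then -oo;
   for a countable abelian group the supremum lies in [0, 1]. *)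
Definition upper_banach_density (R : realType) (A : zmodType) (E : set A) : \bar R :=
  ereal_sup [set limn_esup (fun n => (rel_density R E (F n))%:E) |
             F in [set F : nat -> {fset A} | folner_seq R F]].

(* Main.v *)
Require Import Defs.
From mathcomp Require Import all_boot all_order all_algebra finmap.
From mathcomp Require Import all_classical all_reals all_analysis.
From mathcomp Require Import ring lra.

(** Put a = x1 - x2 and b = x1 + x2; as 2 is invertible, these are linear
    coordinates on K^2 in which the form u1^2 - u2^2 becomes the product a b.
    So E must have two points whose difference (a, b) satisfies a b = z.
    Suppose it has none.

    Averaging along a Folner sequence where E has density at least d > 0, and
    taking a generalized limit, gives the correlation function
    G(p) = density of {x | x and x + p in E}. It is even, takes values in
    [0, 1], vanishes where a b = z, and is positive definite, even after
    subtraction of the constant d^2 (lemma density_correlation). These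
    properties survive averaging over the dilations (a, b) |-> (t a, b / t),
    which preserve a b. The group K^* is abelian and countable, so G may be
    replaced by a function that is invariant under all of them (lemma
    invariant_correlation).

    Write phi(w) = G(1, w). By invariance G(a, b) = phi(a b) whenever a is
    nonzero, and G is constant on the nonzero points of the vertical axis.
    View the point masses at p as vectors v_p with Gram matrix G(p - q). The
    differences of vectors v_(1, w) for distinct w are then orthogonal as soon
    as they involve disjoint sets of points, and a Bessel inequality against
    v_0 forbids phi from oscillating: it has a limit l along the complements
    of finite sets (lemma corr_cofinite_limit). For nonzero z and w, the vectors
    v_(t, z/t) - v_(t, w/t) all have the same inner product phi(z) - phi(w)
    with v_0. They are bounded and asymptotically orthogonal, because the
    product of the coordinates of (t, z/t) - p takes each value only finitely
    often, so that G there tends to l for every p off the vertical axis.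
    Again by Bessel phi(z) = phi(w): phi is constant away from 0 (lemma
    corr_hyperbola). If phi(z) = 0 for one nonzero z, then G(a, b) = 0 whenever
    a and b are nonzero, so the vectors v_(x, x) are orthogonal; the sum of N
    of them has square norm at most N, but at least d^2 N^2, which is absurd
    for large N. For z = 0 the contradiction is just G(0) >= d^2 > 0. *)

Set Implicit Arguments.
Unset Strict Implicit.
Unset Printing Implicit Defensive.

Import Order.TTheory GRing.Theory Num.Theory.
Import numFieldNormedType.Exports.
Local Open Scope classical_set_scope.
Local Open Scope ring_scope.

(** * Generalized limits of bounded sequences *)

Lemma fmap_ultra (T U : Type) (f : T -> U) (F : set_system T) :
  UltraFilter F -> UltraFilter (f @ F).
Proof.
move=> FU; split=> [|H HF leH]; first exact: fmap_proper_filter.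
rewrite eqEsubset; split => // A HA.
have [//|FnA] := in_ultra_setVsetC (f @^-1` A) FU.
have /filter_ex[? []] : H (A `&` ~` A) by apply: filterI => //; exact: leH.
by [].
Qed.

Section GeneralizedLimit.
Variable R : realType.
Implicit Types (u v : nat -> R) (a l : R).

Definition bounded_seq u := exists M, forall n, `|u n| <= M.

(** A Banach limit without its shift invariance, which is recovered below
    by taking Cesaro means first. *)
Record generalized_limit (L : (nat -> R) -> R) : Prop := GeneralizedLimit {
  glim_linear : forall a u v, bounded_seq u -> bounded_seq v ->
    L (fun n => a * u n + v n) = a * L u + L v ;
  glim_ge0 : forall u, bounded_seq u -> (forall n, 0 <= u n) -> 0 <= L u ;
  glim_cvg : forall u l, bounded_seq u -> u @ \oo --> l -> L u = l }.

(** The limit along an ultrafilter finer than the filter at infinity; it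
    exists for bounded sequences because segments are compact. *)
Lemma generalized_limit_exists : exists L, generalized_limit L.
Proof.
have [G [GU leG]] := ultraFilterLemma (F := \oo) eventually_filter.
have cvG u : bounded_seq u -> u @ G --> lim (u @ G).
  move=> [M uM]; apply/cvg_ex.
  have uG : UltraFilter (u @ G) by exact: fmap_ultra.
  have := @segment_compact R (- M) M; rewrite compact_ultra => /(_ _ uG) [].
    have -> : [set` `[- M, M]] = [set x : R | `|x| <= M].
      by apply/seteqP; split=> x /=; rewrite in_itv /= ler_norml.
    by apply: (@filterS _ G _ setT) => [n _|]; [exact: uM|exact: filterT].
  by move=> l [_ ?]; exists l.
exists (fun u => lim (u @ G)); split.
- move=> a u v /cvG cu /cvG cv; apply: cvg_lim => //.
  by apply: cvgD => //; apply: cvgM => //; exact: cvg_cst.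
- move=> u /cvG cu u0; apply: limr_ge; first by apply/cvg_ex; eexists; exact: cu.
  exact: nearW.
- move=> u l _ ul; apply: cvg_lim => //; apply: cvg_trans ul.
  by move=> A /leG.
Qed.

Lemma bounded_cst a : bounded_seq (fun=> a).
Proof. by exists `|a|. Qed.

Lemma bounded_lin a u v : bounded_seq u -> bounded_seq v ->
  bounded_seq (fun n => a * u n + v n).
Proof.
move=> [M uM] [N vN]; exists (`|a| * M + N) => n.
by rewrite (le_trans (ler_normD _ _))// lerD// normrM ler_wpM2l.
Qed.

Variables (L : (nat -> R) -> R) (gL : generalized_limit L).

Lemma glim_cst a : L (fun=> a) = a.
Proof. by apply: (glim_cvg gL); [exact: bounded_cst|exact: cvg_cst]. Qed.

Lemma glimB u v : bounded_seq u -> bounded_seq v ->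
  L (fun n => u n - v n) = L u - L v.
Proof.
move=> bu bv; have := glim_linear gL (-1) bv bu.
rewrite mulN1r addrC => <-; congr L; apply/funext => n; ring.
Qed.

Lemma boundedB u v : bounded_seq u -> bounded_seq v ->
  bounded_seq (fun n => u n - v n).
Proof.
move=> bu bv; have := bounded_lin (-1) bv bu.
by congr bounded_seq; apply/funext => n; ring.
Qed.

Lemma glim_le u v : bounded_seq u -> bounded_seq v ->
  (forall n, u n <= v n) -> L u <= L v.
Proof.
move=> bu bv uv; rewrite -subr_ge0 -glimB//; apply: (glim_ge0 gL).
  exact: boundedB.
by move=> n; rewrite subr_ge0.
Qed.

Lemma eq_glim u v : bounded_seq u -> bounded_seq v ->
  (fun n => u n - v n) @ \oo --> 0 -> L u = L v.
Proof.
move=> bu bv uv; apply/eqP; rewrite -subr_eq0 -glimB//; apply/eqP.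
by apply: (glim_cvg gL) => //; exact: boundedB.
Qed.

Lemma bounded_sum (I : Type) (r : seq I) (c : I -> R) (u : I -> nat -> R) :
  (forall i, bounded_seq (u i)) ->
  bounded_seq (fun n => \sum_(i <- r) c i * u i n).
Proof.
move=> bu; elim: r => [|i r IH].
  by exists 0 => n; rewrite big_nil normr0.
have := bounded_lin (c i) (bu i) IH; congr bounded_seq.
by apply/funext => n; rewrite big_cons.
Qed.

Lemma glim_sum (I : Type) (r : seq I) (c : I -> R) (u : I -> nat -> R) :
  (forall i, bounded_seq (u i)) ->
  L (fun n => \sum_(i <- r) c i * u i n) = \sum_(i <- r) c i * L (u i).
Proof.
move=> bu; elim: r => [|i r IH].
  rewrite big_nil -[RHS]glim_cst; congr L; apply/funext => n.
  by rewrite big_nil.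
rewrite big_cons -IH -(glim_linear gL (c i) (bu i) (bounded_sum r c bu)).
by congr L; apply/funext => n; rewrite big_cons.
Qed.

Lemma bounded_itv01 u : (forall n, 0 <= u n <= 1) -> bounded_seq u.
Proof.
by move=> u01; exists 1 => n; have /andP[? ?] := u01 n; rewrite ger0_norm.
Qed.

Lemma glim_itv01 u : (forall n, 0 <= u n <= 1) -> 0 <= L u <= 1.
Proof.
move=> u01; have bu := bounded_itv01 u01; apply/andP; split.
  by apply: (glim_ge0 gL) => // n; have /andP[] := u01 n.
rewrite -[leRHS]glim_cst; apply: glim_le => //; first exact: bounded_cst.
by move=> n; have /andP[] := u01 n.
Qed.

End GeneralizedLimit.

(** * Correlation functions and their invariant means *)

Section Correlation.
Variables (R : realType) (A : zmodType).
Implicit Types (X Y Z : seq (R * A)) (D : set A) (d : R) (G : A -> R).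

(** A list of pairs (c, p) stands for the finitely supported signed measure
    that puts mass c at p; this is the bilinear form with kernel G (p - q). *)
Definition pairing G X Y : R :=
  \sum_(x <- X) \sum_(y <- Y) x.1 * y.1 * G (x.2 - y.2).

Definition mass X : R := \sum_(x <- X) x.1.

(** The lower bound [corr_psd] says that G - d^2 is positive definite, where
    positive semidefiniteness of G alone would allow density zero. *)
Record correlation D d G : Prop := Correlation {
  corr_itv01 : forall p, 0 <= G p <= 1 ;
  corr_even : forall p, G (- p) = G p ;
  corr_avoid : forall p, D p -> G p = 0 ;
  corr_psd : forall X, (d * mass X) ^+ 2 <= pairing G X X }.

Lemma pairing_allpairs G X Y : pairing G X Y =
  \sum_(z <- [seq (x, y) | x <- X, y <- Y]) z.1.1 * z.2.1 * G (z.1.2 - z.2.2).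
Proof. by rewrite big_allpairs. Qed.

Lemma pairing_catl G X Y Z : pairing G (X ++ Y) Z = pairing G X Z + pairing G Y Z.
Proof. by rewrite /pairing big_cat. Qed.

Lemma pairing_catr G X Y Z : pairing G X (Y ++ Z) = pairing G X Y + pairing G X Z.
Proof. by rewrite /pairing -big_split; apply: eq_bigr => x _; rewrite big_cat. Qed.

Lemma pairingC G X Y : (forall p, G (- p) = G p) -> pairing G X Y = pairing G Y X.
Proof.
move=> evenG; rewrite /pairing exchange_big; apply: eq_bigr => y _.
by apply: eq_bigr => x _; rewrite (mulrC x.1) -evenG opprB.
Qed.

Lemma corr_comp D D' d G (T : A -> A) : (forall p q, T (p - q) = T p - T q) ->
  (forall p, D' p -> D (T p)) -> correlation D d G -> correlation D' d (G \o T).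
Proof.
move=> TB TD cG.
have T0 : T 0 = 0 by have := TB 0 0; rewrite !subrr.
have TN p : T (- p) = - T p by rewrite -[- p]add0r TB T0 add0r.
split=> [p|p|p /TD|X] /=.
- exact: corr_itv01 cG _.
- by rewrite TN (corr_even cG).
- exact: corr_avoid cG _.
- pose TX := [seq (x.1, T x.2) | x <- X].
  have -> : mass X = mass TX by rewrite /mass big_map.
  apply: le_trans (corr_psd cG TX) _; rewrite /pairing big_map le_eqVlt.
  apply/orP; left; apply/eqP; apply: eq_bigr => x _; rewrite big_map.
  by apply: eq_bigr => y _; rewrite /= TB.
Qed.

Lemma corr_average D d n (G : nat -> A -> R) :
  (forall k, correlation D d (G k)) ->
  correlation D d (fun p => n.+1%:R^-1 * \sum_(k < n.+1) G k p).
Proof.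
move=> cG; have n0 : (0 : R) < n.+1%:R by rewrite ltr0n.
have cst (a : R) : \sum_(k < n.+1) a = n.+1%:R * a.
  by rewrite sumr_const card_ord mulr_natl.
split=> [p|p|p Dp|X].
- rewrite ler_pdivlMl// mulr0 ler_pdivrMl//.
  rewrite sumr_ge0 => [|k _]; last by case/andP: (corr_itv01 (cG k) p).
  by rewrite -cst ler_sum// => k _; case/andP: (corr_itv01 (cG k) p).
- by congr (_ * _); apply: eq_bigr => k _; rewrite (corr_even (cG k)).
- by rewrite big1 ?mulr0// => k _; exact: corr_avoid (cG k) p Dp.
- have -> : pairing (fun p => n.+1%:R^-1 * \sum_(k < n.+1) G k p) X X =
      n.+1%:R^-1 * \sum_(k < n.+1) pairing (G k) X X.
    rewrite exchange_big mulr_sumr; apply: eq_bigr => x _ /=.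
    rewrite exchange_big mulr_sumr; apply: eq_bigr => y _ /=.
    by rewrite mulrCA mulr_sumr.
  by rewrite ler_pdivlMl// -cst ler_sum// => k _; exact: corr_psd (cG k) X.
Qed.

Definition cesaro G (T : A -> A) (n : nat) (p : A) : R :=
  n.+1%:R^-1 * \sum_(k < n.+1) G (iter k T p).

Lemma cesaro_correlation D d G (T : A -> A) n :
  (forall p q, T (p - q) = T p - T q) -> (forall p, D p -> D (T p)) ->
  correlation D d G -> correlation D d (cesaro G T n).
Proof.
move=> TB TD cG; apply: (corr_average n (G := fun k => G \o iter k T)) => k.
apply: corr_comp cG => [p q|p Dp]; elim: k => //= k; first by move=> ->; rewrite TB.
exact: TD.
Qed.

Section Limits.
Variables (L : (nat -> R) -> R) (gL : generalized_limit L).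

Lemma glim_correlation D d (G : nat -> A -> R) :
  (forall n, correlation D d (G n)) -> correlation D d (fun p => L (G^~ p)).
Proof.
move=> cG; have G01 p n : 0 <= G n p <= 1 by exact: corr_itv01 (cG n) p.
have bG p : bounded_seq (G^~ p) by apply: bounded_itv01.
split.
- by move=> p; exact: glim_itv01.
- by move=> p; congr L; apply/funext => n; exact: corr_even (cG n) p.
- move=> p Dp; rewrite -[RHS](glim_cst gL); congr L; apply/funext => n.
  exact: corr_avoid (cG n) p Dp.
- move=> X; rewrite pairing_allpairs.
  rewrite -(glim_sum gL _ _ (fun z => bG (z.1.2 - z.2.2))).
  rewrite -[leLHS](glim_cst gL); apply: (glim_le gL).
  + exact: bounded_cst.
  + exact: (bounded_sum _ _ (fun z => bG (z.1.2 - z.2.2))).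
  + by move=> n; rewrite -pairing_allpairs; exact: corr_psd (cG n) X.
Qed.

Definition invariant_mean G (T : A -> A) (p : A) : R := L ((cesaro G T)^~ p).

(** The means over [0, n] at T p and at p differ by a telescoping term of
    size at most 1 / (n + 1). *)
Lemma invariant_meanT G (T : A -> A) p : (forall p, 0 <= G p <= 1) ->
  invariant_mean G T (T p) = invariant_mean G T p.
Proof.
move=> G01.
have bc q : bounded_seq ((cesaro G T)^~ q).
  apply: bounded_itv01 => n.
  rewrite ler_pdivlMl ?ltr0n// mulr0 ler_pdivrMl ?ltr0n//.
  rewrite sumr_ge0 => [|k _]; last by case/andP: (G01 (iter k T q)).
  rewrite mulr1 -[n.+1 in leRHS]card_ord -sumr_const ler_sum// => k _.
  by case/andP: (G01 (iter k T q)).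
apply: (eq_glim gL (bc _) (bc _)).
have -> : (fun n => cesaro G T n (T p) - cesaro G T n p) =
    (fun n => n.+1%:R^-1 * (G (iter n.+1 T p) - G p)).
  apply/funext => n; rewrite /cesaro -mulrBr; congr (_ * _).
  under eq_bigr do rewrite -iterSr.
  rewrite big_ord_recr [in X in _ - X]big_ord_recl /=.
  by rewrite addrC opprD addrACA subrr addr0.
apply/cvgr0Pnorm_le => e e0.
have := @cvg_harmonic R; move/cvgr0Pnorm_le => /(_ _ e0).
apply: filterS => n /= he; apply: le_trans he.
rewrite normrM -[leRHS]mulr1 ler_wpM2l//.
have /andP[a0 a1] := G01 (iter n.+1 T p); have /andP[b0 b1] := G01 p.
by rewrite /= in a0 a1 *; rewrite ler_norml; apply/andP; split; lra.
Qed.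

Lemma invariant_mean_comm G (S T : A -> A) :
  (forall p, S (T p) = T (S p)) -> (forall p, G (S p) = G p) ->
  forall p, invariant_mean G T (S p) = invariant_mean G T p.
Proof.
move=> ST GS p; congr L; apply/funext => n; congr (_ * _).
apply: eq_bigr => k _; rewrite -[RHS]GS; congr G.
by elim: (k : nat) => //= j ->; rewrite ST.
Qed.

Variables (T : nat -> A -> A).
Hypothesis TB : forall k p q, T k (p - q) = T k p - T k q.
Hypothesis TC : forall j k p, T j (T k p) = T k (T j p).

(** Averaging over T n leaves intact the invariance under T 0, ..., T (n - 1)
    that was obtained before, because the maps commute. *)
Fixpoint successive_means G n : A -> R :=
  if n is m.+1 then invariant_mean (successive_means G m) (T m) else G.

(** The n-th successive mean is invariant under T k as soon as k < n, so their
    generalized limit is invariant under every T k: this is amenability of a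
    countable commuting family. *)
Lemma invariant_correlation D d G :
  (forall k p, D p -> D (T k p)) -> correlation D d G ->
  exists2 H, correlation D d H & forall k p, H (T k p) = H p.
Proof.
move=> TD cG.
have cS n : correlation D d (successive_means G n).
  elim: n => //= n IH; apply: glim_correlation => m.
  by exact: cesaro_correlation (@TB n) (@TD n) IH.
have inv n k p : (k < n)%N ->
    successive_means G n (T k p) = successive_means G n p.
  elim: n p => //= n IH p; rewrite ltnS leq_eqVlt => /predU1P[->|kn].
    exact/invariant_meanT/corr_itv01/cS.
  by apply: invariant_mean_comm => // q; exact: IH.
exists (fun p => L ((successive_means G)^~ p)); first exact: glim_correlation.
move=> k p; apply: (eq_glim gL); rewrite ?/bounded_seq.
- by apply: bounded_itv01 => n; exact: corr_itv01 (cS n) _.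
- by apply: bounded_itv01 => n; exact: corr_itv01 (cS n) _.
- apply: cvg_near_cst; exists k.+1 => // n /= kn.
  by rewrite inv ?subrr.
Qed.

End Limits.
End Correlation.

(** * Almost orthogonal sequences *)

Section AlmostOrthogonal.
Variables (R : realType) (A : zmodType) (D : set A) (d : R) (G : A -> R).
Hypothesis cG : correlation D d G.
Implicit Types (X Y e : seq (R * A)) (c : R) (p : A).

Lemma pairing_seq1r X c p :
  pairing G X [:: (c, p)] = c * pairing G X [:: (1, p)].
Proof.
rewrite /pairing mulr_sumr; apply: eq_bigr => x _.
by rewrite !big_seq1 mulr1 /= mulrA (mulrC c).
Qed.

Lemma pairing_seq2l p q X : pairing G [:: (1, p); (-1, q)] X =
  \sum_(x <- X) x.1 * (G (p - x.2) - G (q - x.2)).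
Proof.
rewrite /pairing big_cons big_seq1 /= -big_split /=; apply: eq_bigr => x _.
by ring.
Qed.

Lemma pairing_diff p q :
  pairing G [:: (1, p); (-1, q)] [:: (1, p); (-1, q)] = 2 * (G 0 - G (p - q)).
Proof.
rewrite pairing_seq2l big_cons big_seq1 /= !subrr -(opprB p q) (corr_even cG).
by ring.
Qed.

(** A quantitative Bessel inequality. If one can keep adding vectors e of
    bounded norm that are nearly orthogonal to the sum X of the previous ones,
    then after n steps X has square norm at most 3 n while its inner product
    with the point mass at 0 is at least n * eta; by Cauchy-Schwarz
    (n * eta)^2 <= 3 n for every n, so eta <= 0. The predicate P is the
    invariant that makes the next choice of e possible. *)
Lemma almost_orthogonal (P : seq (R * A) -> Prop) (eta : R) : P [::] ->
  (forall X, P X -> exists e, [/\ P (e ++ X), pairing G e e <= 2,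
     pairing G e X <= 2^-1 & eta <= pairing G e [:: (1, 0)]]) ->
  eta <= 0.
Proof.
move=> P0 step; rewrite leNgt; apply/negP => eta0.
have grow n : exists X, [/\ P X, pairing G X X <= 3 * n%:R &
    n%:R * eta <= pairing G X [:: (1, 0)]].
  elim: n => [|n [X [PX XX Xv]]].
    by exists [::]; split; rewrite // /pairing big_nil ?mulr0 ?mul0r.
  have [e [PeX ee eX ev]] := step X PX; exists (e ++ X); split => //.
    rewrite pairing_catl !pairing_catr (pairingC X e (corr_even cG)) -natr1.
    by lra.
  by rewrite pairing_catl -natr1; lra.
have [n nx] : exists n : nat, 3 / eta ^+ 2 < n%:R.
  by exists (Num.truncn (3 / eta ^+ 2)).+1; exact: truncnS_gt.
have [X [_ XX Xv]] := grow n.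
have n0 : 0 < n%:R * eta.
  by rewrite mulr_gt0// (le_lt_trans _ nx)// divr_ge0// exprn_ge0 ?ltW.
rewrite ltr_pdivrMr ?exprn_gt0// in nx.
(* Cauchy-Schwarz: test positivity on X minus n * eta times the mass at 0. *)
have := corr_psd cG (X ++ [:: (- (n%:R * eta), 0)]).
rewrite pairing_catl !pairing_catr (pairingC [:: _] X (corr_even cG)).
rewrite (pairing_seq1r X (- _)).
have -> : pairing G [:: (- (n%:R * eta), 0)] [:: (- (n%:R * eta), 0)] =
    (n%:R * eta) ^+ 2 * G 0.
  by rewrite /pairing !big_seq1 /= subrr; ring.
move=> /(le_trans (sqr_ge0 _)) psd.
have /andP[_ G01] := corr_itv01 cG 0.
have h1 : (n%:R * eta) ^+ 2 * G 0 <= (n%:R * eta) ^+ 2.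
  by rewrite ler_piMr// sqr_ge0.
have h2 : (n%:R * eta) * (n%:R * eta) <= (n%:R * eta) * pairing G X [:: (1, 0)].
  by rewrite ler_wpM2l// ltW.
have h3 : (n%:R * eta) * (n%:R * eta) > 3 * n%:R.
  have -> : n%:R * eta * (n%:R * eta) = (n%:R * eta ^+ 2) * n%:R by ring.
  by rewrite ltr_pM2r//; move: n0; rewrite pmulr_lgt0.
by lra.
Qed.

End AlmostOrthogonal.

(** * Dilation-invariant correlations on the plane *)

Lemma finite_set_root (K : idomainType) (q : {poly K}) :
  q != 0 -> finite_set [set x | root q x].
Proof.
move=> q0; apply: contrapT => /(infinite_set_fset (size q))[B Bq].
rewrite leqNgt => /negP; apply; apply: max_poly_roots q0 _ (finmap.fset_uniq B).
by apply/allP => x xB; exact: Bq.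
Qed.

(** The equation is quadratic in t, with nonzero constant term - p.1 * z. *)
Lemma finite_hyperbola_fibre (K : fieldType) (z : K) (p : K * K) (w : K) :
  z != 0 -> p.1 != 0 ->
  finite_set [set t | t != 0 /\ (t - p.1) * (z / t - p.2) = w].
Proof.
move=> z0 p0.
pose q : {poly K} := - p.2 *: 'X^2 + (z + p.1 * p.2 - w) *: 'X - (p.1 * z)%:P.
have q0 : q != 0.
  apply: contraNneq (mulf_neq0 p0 z0) => /(congr1 (horner^~ 0)) /eqP.
  by rewrite !hornerE /= !(mulr0, expr0n, add0r) oppr_eq0.
apply: sub_finite_set (finite_set_root q0) => t [t0 tw] /=.
by rewrite /root /q -tw !hornerE /=; apply/eqP; field.
Qed.

Section InvariantCorrelation.
Variables (R : realType) (K : fieldType) (D : set (K * K)) (d : R).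
Variable G : K * K -> R.
Hypothesis Kinf : infinite_set [set: K].
Hypothesis cG : correlation D d G.
Hypothesis GT : forall t, t != 0 -> forall p, G (t * p.1, t^-1 * p.2) = G p.
Implicit Types (a b : R) (w z t : K) (X : seq (R * (K * K))).

Lemma corr_mulE x y : x != 0 -> G (x, y) = G (1, x * y).
Proof. by move=> x0; rewrite -(GT (invr_neq0 x0)) /= mulVf// invrK. Qed.

Lemma corr_vertical y : y != 0 -> G (0, y) = G (0, 1).
Proof. by move=> y0; rewrite -(GT y0) /= mulr0 mulVf. Qed.

Lemma infinite_pick (S : set K) (B : set K) : infinite_set S -> finite_set B ->
  exists2 x, S x & ~ B x.
Proof.
move=> Sinf Bfin.
by have [x []] := infinite_setN0 (infinite_setD Sinf Bfin); exists x.
Qed.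

(** Take e to be the difference of the masses at (1, w') and (1, w), where
    G (1, w) <= a and b <= G (1, w'). All points used lie on the vertical line
    through (1, 0), where G (p - q) is the same for all distinct p and q, so
    e is exactly orthogonal to every X that avoids its two points. *)
Lemma corr_no_oscillation a b : a < b ->
  infinite_set [set w | G (1, w) <= a] ->
  infinite_set [set w | b <= G (1, w)] -> False.
Proof.
move=> ab infa infb.
suff : b - a <= 0 by rewrite subr_le0 leNgt ab.
apply: (almost_orthogonal cG
  (P := fun X => forall x, x \in X -> x.2.1 = 1)) => // X X1.
have fX : finite_set [set` [seq x.2.2 | x <- X]] by exact: finite_seq.
have [w wa wX] := infinite_pick infa fX.
have [w' w'b w'X] := infinite_pick infb fX.
exists [:: (1, (1, w')); (-1, (1, w))]; split.
- by move=> x; rewrite mem_cat => /orP[|]; [rewrite !inE => /orP[]/eqP->|exact: X1].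
- rewrite (pairing_diff cG).
  have /andP[_ ?] := corr_itv01 cG 0.
  have /andP[? _] := corr_itv01 cG ((1, w') - (1, w)); lra.
- rewrite pairing_seq2l big_seq big1 ?invr_ge0// => x xX.
  have GX v : ~ [set` [seq x.2.2 | x <- X]] v -> G ((1, v) - x.2) = G (0, 1).
    move=> vX; have -> : (1, v) - x.2 = (0, v - x.2.2).
      case: x xX (X1 x xX) => c [x1 x2] /= _ ->.
      by rewrite -[LHS]/(1 - 1, v - x2) subrr.
    apply: corr_vertical; rewrite subr_eq0; apply/eqP => vx.
    by apply: vX; rewrite vx /=; apply/mapP; exists x.
  by rewrite !GX// subrr mulr0.
- by rewrite pairing_seq2l big_seq1 /= !subr0 mul1r lerB.
Qed.

(** The limit is the infimum of the levels a such that G (1, w) <= a for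
    infinitely many w; the absence of oscillation bounds G from above. *)
Lemma corr_cofinite_limit :
  exists l : R, forall e, 0 < e -> finite_set [set w | e <= `|G (1, w) - l|].
Proof.
pose S := [set a | infinite_set [set w | G (1, w) <= a]].
have S1 : S 1.
  apply: sub_infinite_set Kinf => w _ /=.
  by case/andP: (corr_itv01 cG (1, w)).
have lbS : lbound S 0.
  move=> a /infinite_setN0[w /=]; apply: le_trans.
  by case/andP: (corr_itv01 cG (1, w)).
have infS : has_inf S by split; [exists 1|exists 0].
exists (inf S) => e e0.
have lo : finite_set [set w | G (1, w) <= inf S - e].
  apply: contrapT => /(ge_inf infS.2); rewrite leNgt gtrBl => /negP; exact.
have hi : finite_set [set w | inf S + e <= G (1, w)].
  have [a Sa ae] := inf_adherent e0 infS.
  by apply: contrapT; exact: corr_no_oscillation ae Sa.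
apply: (@sub_finite_set _ _ _ _ (_ : finite_set (_ `|` _))); last first.
  by rewrite finite_setU; split; [exact: lo|exact: hi].
move=> w /=; rewrite ler_normr => /orP[] h; [right|left]; lra.
Qed.

(** Take e_t to be the difference of the masses at (t, z / t) and (t, w / t).
    For all t outside a finite set it is nearly orthogonal to any given X off
    the vertical axis, since both of its masses have inner product close to
    the cofinite limit with each mass of X. *)
Lemma corr_hyperbola_le z w : z != 0 -> w != 0 -> G (1, z) - G (1, w) <= 0.
Proof.
move=> z0 w0; have [l lP] := corr_cofinite_limit.
(* Each bad value of the product is taken for finitely many t only. *)
have near_l y p e : y != 0 -> p.1 != 0 -> 0 < e ->
    finite_set [set t | t != 0 /\ e <= `|G ((t, y / t) - p) - l|].
  move=> y0 p0 e0.
  pose B := [set v | e <= `|G (1, v) - l|].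
  apply: (@sub_finite_set _ _ ([set p.1] `|`
      \bigcup_(v in B) [set t | t != 0 /\ (t - p.1) * (y / t - p.2) = v])).
    move=> t [t0 tl]; have [->|tp] := eqVneq t p.1; [by left|right].
    exists ((t - p.1) * (y / t - p.2)) => //.
    by rewrite /B /= -corr_mulE ?subr_eq0.
  rewrite finite_setU; split; first exact: finite_set1.
  by apply: bigcup_finite; [exact: lP|move=> v _; exact: finite_hyperbola_fibre].
(* Subtracting the two approximations cancels the limit l. *)
have small X e : (forall x, x \in X -> x.2.1 != 0) -> 0 < e ->
    finite_set [set t | t != 0 /\
      e <= `|pairing G [:: (1, (t, z / t)); (-1, (t, w / t))] X|].
  elim: X e => [|x X IH] e X0 e0.
    rewrite [X in finite_set X](_ : _ = set0)//.
    apply/seteqP; split=> [t [_]|//].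
    by rewrite pairing_seq2l big_nil normr0 leNgt e0.
  have c0 : 0 < 4 * (`|x.1| + 1) by rewrite mulr_gt0// ltr_wpDl.
  have e1 : 0 < e / (4 * (`|x.1| + 1)) by rewrite divr_gt0.
  have x0 : x.2.1 != 0 by apply: X0; rewrite mem_head.
  have X1 y : y \in X -> y.2.1 != 0 by move=> yX; apply: X0; rewrite inE yX orbT.
  have e2 : 0 < e / 2 by rewrite divr_gt0.
  have fz := near_l _ _ _ z0 x0 e1; have fw := near_l _ _ _ w0 x0 e1.
  have fX := IH _ X1 e2.
  apply: (@sub_finite_set _ _ _ _ (_ : finite_set (_ `|` (_ `|` _)))); last first.
    by rewrite !finite_setU; split; [exact: fz|split; [exact: fw|exact: fX]].
  move=> t [t0]; rewrite !pairing_seq2l big_cons => et.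
  apply: contrapT => /not_orP[hz /not_orP[hw hX]].
  have {}hz : `|G ((t, z / t) - x.2) - l| < e / (4 * (`|x.1| + 1)).
    by rewrite ltNge; apply/negP => h; exact: hz.
  have {}hw : `|G ((t, w / t) - x.2) - l| < e / (4 * (`|x.1| + 1)).
    by rewrite ltNge; apply/negP => h; exact: hw.
  have {}hX : `|\sum_(y <- X)
      y.1 * (G ((t, z / t) - y.2) - G ((t, w / t) - y.2))| < e / 2.
    by rewrite ltNge; apply/negP => h; apply: hX; split=> //; rewrite pairing_seq2l.
  move: et; rewrite leNgt => /negP; apply.
  apply: le_lt_trans (ler_normD _ _) _.
  rewrite [ltRHS](splitr e) ler_ltD// normrM.
  have hd : `|G ((t, z / t) - x.2) - G ((t, w / t) - x.2)| <=
      2 * (e / (4 * (`|x.1| + 1))).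
    have -> : G ((t, z / t) - x.2) - G ((t, w / t) - x.2) =
      (G ((t, z / t) - x.2) - l) - (G ((t, w / t) - x.2) - l) by ring.
    by apply: le_trans (ler_normB _ _) _; lra.
  apply: (@le_trans _ _ ((`|x.1| + 1) * (2 * (e / (4 * (`|x.1| + 1)))))).
    by rewrite ler_pM// lerDl.
  rewrite le_eqVlt; apply/orP; left; apply/eqP; field.
  by rewrite gt_eqF// ltr_wpDl.
apply: (almost_orthogonal cG
  (P := fun X => forall x, x \in X -> x.2.1 != 0)) => // X X0.
have half0 : 0 < 2^-1 :> R by rewrite invr_gt0.
have fX := small X 2^-1 X0 half0.
have f0X : finite_set ([set 0] `|` [set t | t != 0 /\ 2^-1 <=
    `|pairing G [:: (1, (t, z / t)); (-1, (t, w / t))] X|]).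
  by rewrite finite_setU; split; [exact: finite_set1|exact: fX].
have [t _ /not_orP[/eqP t0 tX]] := infinite_pick Kinf f0X.
exists [:: (1, (t, z / t)); (-1, (t, w / t))]; split.
- by move=> x; rewrite mem_cat => /orP[|]; [rewrite !inE => /orP[]/eqP->|exact: X0].
- rewrite (pairing_diff cG).
  have /andP[_ ?] := corr_itv01 cG 0.
  have /andP[? _] := corr_itv01 cG ((t, z / t) - (t, w / t)); lra.
- apply: le_trans (ler_norm _) _; apply: ltW; rewrite ltNge; apply/negP => h.
  exact: tX.
- rewrite pairing_seq2l big_seq1 /= !subr0 mul1r.
  by rewrite !(corr_mulE _ t0) !(mulrC t) !divfK.
Qed.

Lemma corr_hyperbola z w : z != 0 -> w != 0 -> G (1, z) = G (1, w).
Proof.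
by move=> ? ?; apply/le_anti/andP; split; rewrite -subr_le0 corr_hyperbola_le.
Qed.

(** Otherwise the masses at the points (x, x) of the diagonal are pairwise
    orthogonal, and a sum of N of them has square norm at most N, whereas the
    density bound requires d^2 N^2. *)
Lemma corr_hyperbola_neq0 z : 0 < d -> z != 0 -> G (1, z) != 0.
Proof.
move=> d0 z0; apply/eqP => Gz.
have Gp x y : x != 0 -> y != 0 -> G (x, y) = 0.
  move=> x0 y0; rewrite corr_mulE// -Gz.
  by apply: corr_hyperbola; rewrite ?mulf_neq0.
have [B _ sB] := infinite_set_fset (Num.truncn (d ^- 2)).+1 Kinf.
set s := finmap.enum_fset B in sB; pose N : R := (size s)%:R.
have dN : d ^- 2 < N.
  by rewrite (lt_le_trans (truncnS_gt _))// ler_nat.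
pose X := [seq (1 : R, (x, x)) | x <- s].
have mX : mass X = N by rewrite /mass big_map big_const_seq count_predT iter_addr_0.
have pX : pairing G X X = \sum_(x <- s) G 0.
  rewrite /pairing big_map; apply: eq_big_seq => x xs /=.
  rewrite big_map (bigD1_seq x) ?finmap.fset_uniq//= big1 ?addr0 => [|y yx].
    by rewrite !mul1r subrr.
  have xy : x - y != 0 by rewrite subr_eq0 eq_sym.
  by rewrite -[X in G X]/(x - y, x - y) Gp// mulr0.
have := corr_psd cG X; rewrite mX pX leNgt => /negP; apply.
have N0 : 0 < N by rewrite (lt_trans _ dN)// invr_gt0 exprn_gt0.
apply: (@le_lt_trans _ _ N).
  rewrite big_const_seq count_predT iter_addr_0 -mulr_natr -/N ler_piMl ?ler0n//.
  by case/andP: (corr_itv01 cG 0).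
rewrite exprMn [N ^+ 2]expr2 mulrA ltr_pMl//.
by rewrite mulrC -ltr_pdivrMr ?exprn_gt0// mul1r.
Qed.

End InvariantCorrelation.

(** * Correlations of a set of positive density *)

Section Density.
Variables (R : realType) (A : zmodType).
Implicit Types (E : set A) (F : {fset A}) (f : A -> R).

Definition average F f : R := (\sum_(x <- F) f x) / #|` F|%:R.

Lemma perm_fsetI F (F' : {fset A}) :
  perm_eq (F `&` F')%fset [seq x <- F | x \in F'].
Proof.
apply: uniq_perm; rewrite ?fset_uniq ?filter_uniq// => x.
by rewrite mem_filter in_fsetI andbC.
Qed.

Lemma rel_densityE E F : rel_density R E F = average F \1_E.
Proof.
rewrite /rel_density /average; congr (_ / _).
have -> : #|` [fset x in F | x \in E]%fset | = count (fun x => x \in E) F.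
  rewrite -size_filter; apply: perm_size; apply: uniq_perm.
  - exact: fset_uniq.
  - by rewrite filter_uniq// fset_uniq.
  - by move=> x; rewrite mem_filter !inE andbC.
by rewrite -sum1_count natr_sum big_mkcond; apply: eq_bigr => x _;
  rewrite indicE; case: ifP.
Qed.

(** The sums over the translate F + b and over F agree on the intersection, and
    each has at most #|F| - #|F :&: (F + b)| terms left, all in [0, 1]. *)
Lemma sum_translate_le F b f : (forall x, 0 <= f x <= 1) ->
  `|\sum_(x <- F) f (x + b) - \sum_(x <- F) f x| <=
    #|` F|%:R - #|` (F `&` ftranslate F b)%fset |%:R.
Proof.
move=> f01; set F' := ftranslate F b.
have -> : \sum_(x <- F) f (x + b) = \sum_(x <- F') f x.
  by rewrite /F' /ftranslate big_imfset//= => x y _ _; exact: addIr.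
have cF' : #|` F'| = #|` F| by rewrite card_imfset//; exact: addIr.
rewrite (bigID (mem F)) [in X in _ - X](bigID (mem F')) /=.
have -> : \sum_(x <- F' | x \in F) f x = \sum_(x <- F | x \in F') f x.
  rewrite -big_filter -[RHS]big_filter -(perm_big _ (perm_fsetI F F')).
  by rewrite -(perm_big _ (perm_fsetI F' F)) fsetIC.
rewrite opprD addrACA subrr add0r.
have bnd (B B' : {fset A}) : 0 <= \sum_(x <- B | x \notin B') f x <=
    #|` B|%:R - #|` (B `&` B')%fset |%:R.
  apply/andP; split; first by apply: sumr_ge0 => x _; case/andP: (f01 x).
  have -> : #|` (B `&` B')%fset | = count (mem B') B.
    by rewrite -size_filter; exact/perm_size/perm_fsetI.
  rewrite -[#|` B|](count_predC (mem B')) natrD [leRHS]addrC addKr.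
  rewrite -sum1_count natr_sum; apply: ler_sum => x _.
  by case/andP: (f01 x).
have /andP[a0 a1] := bnd F' F; have /andP[b0 b1] := bnd F F'.
by rewrite cF' fsetIC -/F' in a1; rewrite ler_norml; apply/andP; split; lra.
Qed.

Lemma average_itv01 F f : F != fset0 -> (forall x, 0 <= f x <= 1) ->
  0 <= average F f <= 1.
Proof.
move=> F0 f01; have F1 : (0 : R) < #|` F|%:R by rewrite ltr0n cardfs_gt0.
rewrite ler_pdivlMr// mul0r ler_pdivrMr// mul1r.
rewrite sumr_ge0 => [|x _]; last by case/andP: (f01 x).
rewrite -sum1_size natr_sum ler_sum// => x _.
by case/andP: (f01 x).
Qed.

(** A subsequence of a Folner sequence is a Folner sequence, so a positive
    upper limit of densities can be turned into a uniform lower bound. *)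
Lemma upper_banach_density_gt0 E : (0%E < upper_banach_density R E)%E ->
  exists F : nat -> {fset A}, folner_seq R F /\
    exists2 d : R, 0 < d & forall n, d <= rel_density R E (F n).
Proof.
move=> /ereal_sup_gt[_ [F Ffol <-]]; set u := fun n => _ => u0.
have [d d0 du] : exists2 d : R, 0 < d & (d%:E < limn_esup u)%E.
  case: (limn_esup u) u0 => [r|_|//]; last by exists 1; rewrite // ltry.
  by rewrite lte_fin => r0; exists (r / 2); rewrite ?lte_fin; lra.
have /choice[k kP] : forall N, exists n, (N <= n)%N /\ d <= rel_density R E (F n).
  move=> N; have : (d%:E < esups u N)%E.
    apply: lt_le_trans du _; rewrite limn_esup_lim.
    rewrite (cvg_lim _ (ereal_nonincreasing_cvgn (@nonincreasing_esups _ u)))//.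
    by apply: ereal_inf_lbound; exists N.
  by move=> /ereal_sup_gt[_ [n /= Nn <-]]; rewrite lte_fin => /ltW; exists n.
exists (F \o k); split; last by exists d => // n; case: (kP n).
split=> [n|b]; first exact: Ffol.1.
apply: (cvg_comp k (fun n => _) _ (Ffol.2 b)) => B [N _ NB].
exists N => // n /= Nn; apply: NB => /=; apply: leq_trans Nn _.
by case: (kP n).
Qed.

Variables (L : (nat -> R) -> R) (gL : generalized_limit L).
Variables (F : nat -> {fset A}) (Ffol : folner_seq R F).

Lemma glim_average_translate f b : (forall x, 0 <= f x <= 1) ->
  L (fun n => average (F n) (fun x => f (x + b))) =
  L (fun n => average (F n) f).
Proof.
move=> f01; have F0 := Ffol.1.
apply: (eq_glim gL).
- by apply: bounded_itv01 => n; apply: average_itv01.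
- by apply: bounded_itv01 => n; apply: average_itv01.
pose r n : R := (#|` (F n `&` ftranslate (F n) b)%fset |)%:R / (#|` F n|)%:R.
have r1 : 1 - r n @[n --> \oo] --> (0 : R).
  rewrite -[X in _ --> X](subrr 1); apply: cvgB; first exact: cvg_cst.
  exact: Ffol.2.
apply/cvgr0Pnorm_le => e e0; move/cvgr0Pnorm_le : r1 => /(_ _ e0).
apply: filterS => n /=; apply: le_trans.
have F1 : (0 : R) < #|` F n|%:R by rewrite ltr0n cardfs_gt0.
rewrite -mulrBl normrM normfV (gtr0_norm F1) ler_pdivrMr//.
apply: le_trans (sum_translate_le _ _ f01) _.
apply: le_trans (ler_norm _) _.
rewrite -[X in _ * X](gtr0_norm F1) -normrM mulrBl mul1r.
by rewrite divfK// gt_eqF.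
Qed.

(** G p is the generalized limit of the density of E and E - p in common.
    By translation invariance G (p - q) is the mean of the product of the
    indicators of E - p and E - q, so the quadratic form is the mean of the
    square of a function g; the square of the mean of g bounds it below. *)
Lemma density_correlation E d : 0 <= d ->
  (forall n, d <= rel_density R E (F n)) ->
  exists G : A -> R,
    correlation [set p | forall x y, E x -> E y -> x - y <> p] d G.
Proof.
move=> d0 dE; have F0 := Ffol.1.
pose u p q n := average (F n) (fun x => \1_E (x + p) * \1_E (x + q)).
pose v p n := average (F n) (fun x => \1_E (x + p)).
have i01 x : 0 <= (\1_E x : R) <= 1.
  by rewrite indicE; case: (_ \in _); rewrite ?ler01 ?lexx.
have ii01 p q x : 0 <= (\1_E (x + p) * \1_E (x + q) : R) <= 1.
  have /andP[p0 p1] := i01 (x + p); have /andP[q0 q1] := i01 (x + q).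
  by rewrite mulr_ge0//= mulr_ile1.
have u01 p q n : 0 <= u p q n <= 1 by exact: average_itv01.
have v01 p n : 0 <= v p n <= 1 by apply: average_itv01.
have bu p q : bounded_seq (u p q) by exact: bounded_itv01.
have bv p : bounded_seq (v p) by exact: bounded_itv01.
have Lu p q b : L (u (p + b) (q + b)) = L (u p q).
  rewrite -[RHS](glim_average_translate b (ii01 p q)).
  by congr L; apply/funext => n; congr average; apply/funext => x;
    rewrite !addrA (addrAC x b p) (addrAC x b q).
have Lv p : L (v p) = L (v 0).
  rewrite -[RHS](glim_average_translate p (fun x => i01 (x + 0))).
  by congr L; apply/funext => n; congr average; apply/funext => x; rewrite addr0.
have uC p q : u p q = u q p.
  by apply/funext => n; congr average; apply/funext => x; rewrite mulrC.
have dL : d <= L (v 0).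
  rewrite -[leLHS](glim_cst gL); apply: (glim_le gL) => //; first exact: bounded_cst.
  move=> n; apply: le_trans (dE n) _; rewrite rel_densityE /v.
  by under [X in _ <= average _ X]funext do rewrite addr0.
exists (fun p => L (u p 0)); split.
- by move=> p; exact: (glim_itv01 gL).
- by move=> p; rewrite -(Lu (- p) 0 p) addNr add0r uC.
- move=> p Ep; rewrite -[RHS](glim_cst gL); congr L; apply/funext => n.
  rewrite /u /average big1 ?mul0r// => x _; rewrite addr0 !indicE.
  have [xpE|] := boolP (x + p \in E); last by rewrite mul0r.
  have [xE|] := boolP (x \in E); last by rewrite mulr0.
  have := Ep _ _ (set_mem xpE) (set_mem xE).
  by rewrite addrC addKr.
move=> X; pose m := mass X * L (v 0).
have Gu p q : L (u (p - q) 0) = L (u p q).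
  by rewrite -(Lu _ _ q) subrK add0r.
have -> : pairing (fun p => L (u p 0)) X X =
    L (fun n => \sum_(z <- [seq (x, y) | x <- X, y <- X])
                  z.1.1 * z.2.1 * u z.1.2 z.2.2 n).
  rewrite (glim_sum gL _ _ (fun z => bu z.1.2 z.2.2)) pairing_allpairs.
  by apply: eq_bigr => z _; rewrite Gu.
(* The convexity bound g^2 >= 2 m g - m^2, with m the mean of g, is linear
   in g and hence passes to the generalized limit. *)
apply: (@le_trans _ _ (2 * m * (\sum_(x <- X) x.1 * L (v x.2)) + - m ^+ 2)).
  have -> : \sum_(x <- X) x.1 * L (v x.2) = m.
    by rewrite /m /mass mulr_suml; apply: eq_bigr => x _; rewrite Lv.
  apply: (@le_trans _ _ (m ^+ 2)); last by rewrite expr2; lra.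
  rewrite /m mulrC !exprMn ler_wpM2l ?sqr_ge0//.
  by rewrite ler_sqr ?nnegrE// (le_trans d0).
have bsv : bounded_seq (fun n => \sum_(x <- X) x.1 * v x.2 n).
  exact: (bounded_sum _ _ (fun x => bv x.2)).
rewrite -(glim_sum gL _ _ (fun x => bv x.2)).
rewrite -[X in _ + X](glim_cst gL (- m ^+ 2)).
rewrite -(glim_linear gL (2 * m) bsv (bounded_cst _)).
apply: (glim_le gL).
- by apply: bounded_lin => //; exact: bounded_cst.
- exact: (bounded_sum _ _ (fun z => bu z.1.2 z.2.2)).
move=> n; pose g x : R := \sum_(y <- X) y.1 * \1_E (x + y.2).
have F1 : (0 : R) < #|` F n|%:R by rewrite ltr0n cardfs_gt0.
have -> : \sum_(x <- X) x.1 * v x.2 n = average (F n) g.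
  rewrite /average exchange_big mulr_suml; apply: eq_bigr => y _ /=.
  by rewrite -mulr_sumr mulrA.
have -> : \sum_(z <- [seq (x, y) | x <- X, y <- X])
    z.1.1 * z.2.1 * u z.1.2 z.2.2 n = average (F n) (fun x => g x ^+ 2).
  rewrite big_allpairs /average.
  have -> : \sum_(x <- F n) g x ^+ 2 = \sum_(x <- F n) \sum_(y <- X) \sum_(y' <- X)
      y.1 * y'.1 * (\1_E (x + y.2) * \1_E (x + y'.2)).
    apply: eq_bigr => x _; rewrite expr2 mulr_suml; apply: eq_bigr => y _.
    by rewrite mulr_sumr; apply: eq_bigr => y' _; ring.
  rewrite [in RHS]exchange_big mulr_suml; apply: eq_bigr => y _ /=.
  rewrite exchange_big mulr_suml; apply: eq_bigr => y' _ /=.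
  by rewrite -mulr_sumr mulrA.
rewrite -subr_ge0.
have -> : average (F n) (fun x => g x ^+ 2) - (2 * m * average (F n) g - m ^+ 2) =
    average (F n) (fun x => (g x - m) ^+ 2).
  rewrite /average; have -> : \sum_(x <- F n) (g x - m) ^+ 2 = \sum_(x <- F n) g x ^+ 2
       - 2 * m * \sum_(x <- F n) g x + #|` F n|%:R * m ^+ 2.
    rewrite mulr_sumr -sumrB -[#|` F n|]sum1_size natr_sum mulr_suml -big_split.
    by apply: eq_bigr => x _ /=; ring.
  by field; rewrite gt_eqF.
by rewrite divr_ge0 ?ler0n// sumr_ge0// => x _; exact: sqr_ge0.
Qed.

End Density.

(** * Values of the hyperbolic form on differences *)

Theorem theorem1p32 (R : realType) (K : fieldType)
  (Kcountable : countable [set: K]) (Kinfinite : infinite_set [set: K])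
  (Kchar : 2%N \notin [pchar K])
  (E : set (K * K)%type)
  (Epos : (0%E < upper_banach_density R E)%E) :
  forall z : K, exists x y : K * K,
    [/\ E x, E y & (x.1 - y.1) ^+ 2 - (x.2 - y.2) ^+ 2 = z].
Proof.
move=> z; apply: contrapT => noz.
have [L gL] := generalized_limit_exists R.
have [F [Ffol [d d0 dE]]] := upper_banach_density_gt0 Epos.
have [G cG] := density_correlation gL Ffol (ltW d0) dE.
have two0 : (2 : K) != 0 by move: Kchar; rewrite inE.
(* The point with difference coordinate p.1 and sum coordinate p.2. *)
pose S (p : K * K) := ((p.1 + p.2) / 2, (p.2 - p.1) / 2).
have SB p q : S (p - q) = S p - S q.
  by congr pair; rewrite /=; field.
have cGS : correlation [set p | p.1 * p.2 = z] d (G \o S).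
  apply: corr_comp SB _ cG => p pz x y Ex Ey xy; apply: noz; exists x, y.
  split=> //; rewrite -[x.1 - y.1]/((x - y).1) -[x.2 - y.2]/((x - y).2) xy /=.
  by rewrite -pz; field.
have [f /(in2TT) finj] := countable_injP _ Kcountable.
(* A sequence through all nonzero elements; the value 1 fills the gaps. *)
have /choice[e eP] : forall n, exists t : K, t != 0 /\
    forall s, s != 0 -> f s = n -> s = t.
  move=> n; have [[t [t0 <-]]|no] := pselect (exists t, t != 0 /\ f t = n).
    by exists t; split=> // s _ /finj.
  by exists 1; split=> [|s s0 sn]; [exact: oner_neq0|case: no; exists s].
pose T k (p : K * K) := (e k * p.1, (e k)^-1 * p.2).
have TB k p q : T k (p - q) = T k p - T k q by rewrite /T /= !mulrBr.
have TC j k p : T j (T k p) = T k (T j p).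
  by rewrite /T /= !(mulrCA (e j), mulrCA (e j)^-1).
have [|H cH HT] := invariant_correlation gL TB TC _ cGS.
  by move=> k p /= <-; rewrite mulrACA mulfV ?mul1r ?(eP k).1.
have HT' t : t != 0 -> forall p, H (t * p.1, t^-1 * p.2) = H p.
  by move=> t0 p; rewrite -(HT (f t) p) /T -((eP (f t)).2 t t0 erefl).
have [z0|z0] := eqVneq z 0.
  have := corr_psd cH [:: (1, 0)].
  rewrite /pairing /mass !big_seq1 /= subrr (corr_avoid cH) ?mulr0//=; last first.
    by rewrite z0 mulr0.
  by rewrite mulr1 leNgt exprn_gt0.
have /eqP[] := corr_hyperbola_neq0 Kinfinite cH HT' d0 z0.
by apply: (corr_avoid cH); rewrite /= mul1r.
Qed.
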